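(* Let $\alpha>0$ be a real number, let $\varphi$ be a real-valued $C^\infty$ function on an open interval of $\mathbb{R}$ containing $0$ whose support is compact and contained in this interval (so $\varphi$ is extended by $0$ to $\mathbb{R}$), and set $$I_\alpha(t)=\int_0^\infty \exp\!\left(i t\,\frac{1}{x^\alpha}\right)\varphi(x)\,dx\qquad (t\in\mathbb{R}).$$ Then $I_\alpha$ is a $C^\infty$ function on $\mathbb{R}\setminus\{0\}$. *)

(* Defs.v *)
From Stdlib Require Import Reals.
From Coquelicot Require Import Coquelicot.
Open Scope R_scope.

(* Used for open D only: derivatives and continuity at x in D are taken in a
   full neighbourhood of x. *)
Fixpoint Ck_on {V : NormedModule R_AbsRing} (k : nat) (D : R -> Prop)
    (f : R -> V) : Prop :=
  match k with
  | O => forall x, D x -> continuous f x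
  | S k' => exists f' : R -> V,
      (forall x, D x -> is_derive f x (f' x)) /\ Ck_on k' D f'
  end.

Definition Cinfty_on {V : NormedModule R_AbsRing} (D : R -> Prop)
    (f : R -> V) : Prop :=
  forall k : nat, Ck_on k D f.

Definition Rbar_ointerval (a b : Rbar) : R -> Prop :=
  fun x => Rbar_lt a x /\ Rbar_lt x b.

Definition tsupport (f : R -> R) : R -> Prop :=
  adherence (fun x => f x <> 0).

Definition Cexp (z : C) : C :=
  (exp (Re z) * cos (Im z), exp (Re z) * sin (Im z)).

(* Improper integral at both ends: over [u, v] with u -> 0+ and v -> +oo, so
   that Rpower is only evaluated at positive x.  It agrees with the Lebesgue
   integral when phi is continuous with compact support, the integrand being
   then bounded, continuous on (0, +oo) and zero for large x. *)
Definition I_alpha (alpha : R) (phi : R -> R) (t : R) : C :=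
  RInt_gen (V := C_R_CompleteNormedModule)
    (fun x : R => Cmult (Cexp (Cmult (Cmult Ci t) (1 / Rpower x alpha))) (phi x))
    (at_right 0) (Rbar_locally p_infty).

(* Main.v *)
(* The kernel e(t, x) = exp(i t / x^alpha) depends only on t / x^alpha, so
   substituting x -> s x gives
     I_psi(t s^alpha) = \int_0^oo e(t, x) s psi(s x) dx,
   where the parameter s has moved from the oscillating kernel to the smooth
   compactly supported amplitude.  A second order Taylor bound at s = 1, uniform
   in x, then shows that s |-> I_psi(t s^alpha) has derivative I_{(x psi)'}(t)
   at s = 1, and with s = (y / t)^(1 / alpha) that
     I_psi'(t) = I_{(x psi)'}(t) / (alpha t).
   Since (x psi)' is again smooth with compact support, this iterates. *)
Require Import Defs.
From Stdlib Require Import Reals Lra Psatz Classical.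
From Coquelicot Require Import Coquelicot.
Open Scope R_scope.

(** * Improper integrals over (0, +oo): convergence, norm bound, dilation *)

Lemma at_right_0_lt (d : R) : 0 < d -> at_right 0 (fun x => 0 < x < d).
Proof.
  intros Hd. exists (mkposreal d Hd). intros y Hy Hpos. split; [exact Hpos|].
  apply (Rle_lt_trans _ (Rabs (minus y 0))); [|exact Hy].
  unfold minus, plus, opp; simpl. rewrite Ropp_0, Rplus_0_r. apply Rle_abs.
Qed.

Section ImproperIntegral.
Context {V : CompleteNormedModule R_AbsRing}.
Variables (f : R -> V) (M B : R).
Hypothesis HM : 0 < M.
Hypothesis Hcont : forall x, 0 < x -> continuous f x.
Hypothesis Hbound : forall x, 0 < x -> norm (f x) <= B.
Hypothesis Hzero : forall x, M <= x -> f x = zero.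

Lemma ex_RInt_pos (u v : R) : 0 < u -> 0 < v -> ex_RInt f u v.
Proof.
  intros Hu Hv. apply (ex_RInt_continuous f). intros z [Hz _]. apply Hcont.
  apply Rlt_le_trans with (2 := Hz). now apply Rmin_pos.
Qed.

Lemma B_nonneg : 0 <= B.
Proof. apply Rle_trans with (1 := norm_ge_0 (f 1)). apply Hbound. lra. Qed.

Lemma norm_RInt_pos (u v : R) :
  0 < u -> 0 < v -> norm (RInt f u v) <= Rabs (v - u) * B.
Proof.
  intros Hu Hv.
  apply norm_RInt_le_const_abs with f.
  - intros x [Hx _]. apply Hbound.
    apply Rlt_le_trans with (2 := Hx). now apply Rmin_pos.
  - apply (RInt_correct f). now apply ex_RInt_pos.
Qed.

Lemma is_RInt_to_cutoff (u v : R) :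
  0 < u -> M <= v -> is_RInt f u v (RInt f u M).
Proof.
  intros Hu Hv.
  rewrite <- (plus_zero_r (RInt f u M)).
  apply (@is_RInt_Chasles V f u M v (RInt f u M) zero).
  - apply (RInt_correct f). now apply ex_RInt_pos.
  - apply is_RInt_ext with (fun _ => zero).
    + intros x [Hx _]. rewrite Hzero; [reflexivity|].
      rewrite Rmin_left in Hx; lra.
    + pose proof (@is_RInt_const V M v zero) as Hc.
      now rewrite (@scal_zero_r R_Ring V) in Hc.
Qed.

(** At the upper end nothing is left to converge, since the integral is constant in v past [M]. At 0
    the Cauchy criterion applies: integrals started at u and v differ by at most |u - v| [B]. The
    bound holds for every lower end in (0, [M]) and passes to the limit. *)
Lemma is_RInt_gen_cutoff :
  exists l : V, is_RInt_gen f (at_right 0) (Rbar_locally p_infty) l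
                /\ norm l <= M * B.
Proof.
  assert (Hlim : exists l : V,
    filterlim (fun u => RInt f u M) (at_right 0) (locally l)).
  { apply (proj1 (@filterlim_locally_cauchy R V (at_right 0) _
      (fun u => RInt f u M))). intros eps.
    pose proof B_nonneg as HB.
    (* [B] may be 0, hence the division by [B + 1]. *)
    assert (Hd : 0 < eps / (B + 1)).
    { apply Rdiv_lt_0_compat; [apply cond_pos | lra]. }
    exists (fun x => 0 < x < eps / (B + 1)).
    split; [now apply at_right_0_lt|].
    intros u v Hu Hv. apply (@norm_compat1 R_AbsRing V).
    assert (E : minus (RInt f v M) (RInt f u M) = RInt f v u).
    { rewrite <- (RInt_Chasles f v u M) by (apply ex_RInt_pos; lra).
      unfold minus. now rewrite <- plus_assoc, (@plus_opp_r V), (@plus_zero_r V). }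
    apply Rle_lt_trans with (norm (RInt f v u)).
    { right. exact (f_equal norm E). }
    apply Rle_lt_trans with (1 := norm_RInt_pos v u (proj1 Hv) (proj1 Hu)).
    assert (Habs : Rabs (u - v) <= eps / (B + 1)) by (apply Rabs_le; lra).
    apply Rle_lt_trans with (eps / (B + 1) * B).
    - now apply Rmult_le_compat_r.
    - apply Rlt_le_trans with (eps / (B + 1) * (B + 1)).
      + apply Rmult_lt_compat_l; lra.
      + right. field. lra. }
  destruct Hlim as [l Hl]. exists l. split.
  - intros P HP. specialize (Hl P HP).
    apply Filter_prod with (fun u => 0 < u /\ P (RInt f u M)) (fun v => M < v).
    + apply filter_and; [|exact Hl].
      apply filter_imp with (2 := at_right_0_lt 1 Rlt_0_1). tauto.
    + now exists M.
    + intros u v [Hu HPu] Hv. exists (RInt f u M). split; [|exact HPu].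
      apply is_RInt_to_cutoff; simpl; lra.
  - change (Rbar_le (norm l) (M * B)).
    apply (filterlim_le (F := at_right 0) (fun u => norm (RInt f u M)) (fun _ => M * B)).
    + apply filter_imp with (2 := at_right_0_lt M HM). intros u Hu.
      apply Rle_trans with (1 := norm_RInt_pos u M (proj1 Hu) HM).
      apply Rmult_le_compat_r; [apply B_nonneg|]. apply Rabs_le. lra.
    + apply filterlim_comp with (1 := Hl). apply (@filterlim_norm R_AbsRing V).
    + apply filterlim_const.
Qed.

End ImproperIntegral.

(** Both filters, at 0+ and at +oo, are preserved by x -> s x for s > 0, so the linear substitution
    on each [u, v] passes to the limit. *)
Lemma is_RInt_gen_dilate {V : NormedModule R_AbsRing} (f : R -> V) (s : R) (l : V) :
  0 < s ->
  is_RInt_gen f (at_right 0) (Rbar_locally p_infty) l ->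
  is_RInt_gen (fun x => scal s (f (s * x))) (at_right 0) (Rbar_locally p_infty) l.
Proof.
  intros Hs Hf P HP. destruct (Hf P HP) as [Q T HQ HT HQT].
  apply Filter_prod with (fun u => Q (s * u)) (fun v => T (s * v)).
  - destruct HQ as [d Hd]. assert (Hd' : 0 < d / s).
    { apply Rdiv_lt_0_compat; [apply cond_pos | exact Hs]. }
    apply filter_imp with (2 := at_right_0_lt _ Hd'). intros u [Hu Hud].
    apply Hd; [|now apply Rmult_lt_0_compat].
    change (Rabs (s * u - 0) < d). rewrite Rminus_0_r, Rabs_pos_eq by nra.
    apply Rmult_lt_compat_l with (r := s) in Hud; [|exact Hs].
    replace (s * (d / s)) with (pos d) in Hud by (field; lra). exact Hud.
  - destruct HT as [K HK]. exists (K / s). intros v Hv. apply HK.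
    apply Rmult_lt_compat_l with (r := s) in Hv; [|exact Hs].
    replace (s * (K / s)) with K in Hv by (field; lra). exact Hv.
  - intros u v Hu Hv. destruct (HQT _ _ Hu Hv) as [y [Hy HPy]].
    exists y. split; [|exact HPy]. simpl in *.
    apply is_RInt_ext with (fun x => scal s (f (s * x + 0))).
    + intros x _. now rewrite Rplus_0_r.
    + apply is_RInt_comp_lin. now rewrite !Rplus_0_r.
Qed.

(** * Calculus of C^k functions on open sets *)

Definition Rfull : R -> Prop := fun _ => True.

Lemma open_Rfull : open Rfull.
Proof. exact open_true. Qed.

Lemma Ck_on_pred {V : NormedModule R_AbsRing} (k : nat) (D : R -> Prop) (f : R -> V) : Ck_on (S k) D f -> Ck_on k D f.
Proof.
  revert f. induction k as [|k IH]; intros f [f' [Hd Hf']].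
  - intros x Hx. apply ex_derive_continuous. exists (f' x). now apply Hd.
  - exists f'. split; [exact Hd|]. now apply IH.
Qed.

Lemma Ck_on_ext {V : NormedModule R_AbsRing} (k : nat) (D : R -> Prop) (f g : R -> V) :
  open D -> (forall x, D x -> f x = g x) -> Ck_on k D f -> Ck_on k D g.
Proof.
  intros HD Heq. destruct k as [|k].
  - intros Hf x Hx. apply continuous_ext_loc with f; [|now apply Hf].
    apply filter_imp with (2 := HD x Hx). exact Heq.
  - intros [f' [Hd Hf']]. exists f'. split; [|exact Hf'].
    intros x Hx. apply is_derive_ext_loc with f; [|now apply Hd].
    apply filter_imp with (2 := HD x Hx). exact Heq.
Qed.

Lemma Ck_on_const {V : NormedModule R_AbsRing} (k : nat) (D : R -> Prop) (c : V) : Ck_on k D (fun _ => c).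
Proof.
  revert c. induction k as [|k IH]; intros c.
  - intros x _. apply continuous_const.
  - exists (fun _ => zero). split; [|apply IH].
    intros x _. apply @is_derive_const.
Qed.

Lemma Ck_on_plus {V : NormedModule R_AbsRing} (k : nat) (D : R -> Prop) (f g : R -> V) :
  Ck_on k D f -> Ck_on k D g -> Ck_on k D (fun x => plus (f x) (g x)).
Proof.
  revert f g. induction k as [|k IH]; intros f g.
  - intros Hf Hg x Hx. apply (continuous_plus f g); auto.
  - intros [f' [Hf Hf']] [g' [Hg Hg']].
    exists (fun x => plus (f' x) (g' x)). split; [|now apply IH].
    intros x Hx. apply (is_derive_plus f g); auto.
Qed.

Lemma is_derive_scal_fct {V : NormedModule R_AbsRing} (h : R -> R) (g : R -> V) (x dh : R) (dg : V) :
  is_derive h x dh -> is_derive g x dg ->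
  is_derive (fun y => scal (h y) (g y)) x (plus (scal dh (g x)) (scal (h x) dg)).
Proof.
  intros Hh Hg.
  eapply filterdiff_ext_lin.
  - apply (@filterdiff_scal_fct R_AbsRing R_NormedModule V x h g
             (fun y => scal y dh) (fun y => scal y dg) Rmult_comm Hh Hg).
  - intros y. simpl. rewrite scal_distr_l, !scal_assoc. f_equal.
    f_equal. apply Rmult_comm.
Qed.

Lemma Ck_on_scal {V : NormedModule R_AbsRing} (k : nat) (D : R -> Prop) (h : R -> R) (g : R -> V) :
  Ck_on (V := R_NormedModule) k D h -> Ck_on k D g ->
  Ck_on k D (fun x => scal (h x) (g x)).
Proof.
  revert h g. induction k as [|k IH]; intros h g Hh Hg.
  - intros x Hx. apply (continuous_scal h g); [now apply Hh | now apply Hg].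
  (* The derivative h' g + h g' contains the factors themselves, so these are also needed at order
     k. *)
  - pose proof (Ck_on_pred _ _ _ Hg) as Hg0.
    pose proof (Ck_on_pred _ _ _ Hh) as Hh0.
    destruct Hh as [h' [Hh Hh']]. destruct Hg as [g' [Hg Hg']].
    exists (fun x => plus (scal (h' x) (g x)) (scal (h x) (g' x))). split.
    + intros x Hx. apply is_derive_scal_fct; auto.
    + apply Ck_on_plus; apply IH; assumption.
Qed.

(** Being C^k is local, and near each point [f] is either C^k or identically 0. The derivative
    satisfies the same dichotomy, because a function vanishing near x has a derivative vanishing
    near x; hence the induction closes. *)
Lemma Ck_on_extend_zero (k : nat) (D : R -> Prop) (f : R -> R) :
  open D -> (forall x, D x \/ locally x (fun y => f y = 0)) ->
  Ck_on (V := R_NormedModule) k D f -> Ck_on (V := R_NormedModule) k Rfull f.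
Proof.
  intros HD. revert f. induction k as [|k IH]; intros f Hloc Hf.
  - intros x _. destruct (Hloc x) as [Hx | Hx]; [now apply Hf|].
    apply continuous_ext_loc with (fun _ => 0); [|apply continuous_const].
    apply filter_imp with (2 := Hx). intros y Hy. now symmetry.
  - destruct Hf as [f' [Hd Hf']].
    assert (Hzero : forall x, locally x (fun y => f y = 0) -> is_derive f x 0).
    { intros x Hx. apply is_derive_ext_loc with (fun _ => 0).
      - apply filter_imp with (2 := Hx). intros y Hy. now symmetry.
      - apply @is_derive_const. }
    (* The given [f'] is unconstrained off [D]; [Derive f] agrees with it on [D] and is correct
       everywhere. *)
    exists (Derive f). split.
    + intros x _. apply Derive_correct. destruct (Hloc x) as [Hx | Hx].
      * exists (f' x). now apply Hd.
      * exists 0. now apply Hzero.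
    + apply IH.
      * intros x. destruct (Hloc x) as [Hx | Hx]; [now left|right].
        apply filter_imp with (2 := locally_locally _ _ Hx).
        intros y Hy. apply is_derive_unique. now apply Hzero.
      * apply Ck_on_ext with f'; [exact HD| |exact Hf'].
        intros x Hx. symmetry. apply is_derive_unique. now apply Hd.
Qed.

Lemma Ck_on_id (k : nat) (D : R -> Prop) :
  Ck_on (V := R_NormedModule) k D (fun x => x).
Proof.
  destruct k as [|k].
  - intros x _. apply continuous_id.
  - exists (fun _ => 1). split.
    + intros x _. apply @is_derive_id.
    + exact (Ck_on_const k D (1 : R_NormedModule)).
Qed.

Lemma Ck_on_Rinv (k : nat) :
  Ck_on (V := R_NormedModule) k (fun x => x <> 0) Rinv.
Proof.
  induction k as [|k IH].
  - intros x Hx. now apply continuous_Rinv.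
  (* Writing -1/x^2 as a product of inverses lets the product rule and the induction hypothesis
     handle it. *)
  - exists (fun x => (- 1) * (/ x * / x)). split.
    + intros x Hx. auto_derive; [exact Hx|]. now field.
    + apply (Ck_on_scal k _ (fun _ => - 1) (fun x => / x * / x)).
      * exact (Ck_on_const k _ (- 1 : R_NormedModule)).
      * exact (Ck_on_scal k _ Rinv Rinv IH IH).
Qed.

(** * Test functions, the operator [dil], and uniform bounds *)

Definition test_function (psi : R -> R) : Prop :=
  Cinfty_on (V := R_NormedModule) Rfull psi /\
  exists M, 0 < M /\ forall x, M < Rabs x -> psi x = 0.

(* The transpose of - x d/dx. *)
Definition dil (psi : R -> R) : R -> R := Derive (fun x => x * psi x).

Lemma Rabs_gt_open (M x : R) : M < Rabs x -> locally x (fun y => M < Rabs y).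
Proof.
  intros Hx.
  exact (open_comp Rabs (fun y => M < y) (fun z _ => continuous_Rabs z) (open_gt M) x Hx).
Qed.

Lemma test_function_dil_Ck (psi : R -> R) (k : nat) :
  test_function psi -> Ck_on (V := R_NormedModule) (S k) Rfull (fun x => x * psi x).
Proof.
  intros [Hpsi _].
  exact (Ck_on_scal (S k) Rfull (fun x => x) psi (Ck_on_id _ _) (Hpsi (S k))).
Qed.

Lemma is_derive_dil (psi : R -> R) (x : R) :
  test_function psi -> is_derive (fun y => y * psi y) x (dil psi x).
Proof.
  intros Hpsi. destruct (test_function_dil_Ck psi 0 Hpsi) as [p [Hp _]].
  apply Derive_correct. exists (p x). now apply Hp.
Qed.

(** Order k for [dil psi] comes from order k + 1 for x psi(x). The same radius [M] works: the set M
    < |x| is open, so vanishing there passes to the derivative. *)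
Lemma test_function_dil (psi : R -> R) : test_function psi -> test_function (dil psi).
Proof.
  intros Hpsi. split.
  - intros k. destruct (test_function_dil_Ck psi k Hpsi) as [p [Hp Hpk]].
    apply Ck_on_ext with p; [exact open_Rfull| |exact Hpk].
    intros x Hx. symmetry. apply is_derive_unique. now apply Hp.
  - destruct Hpsi as [_ [M [HM Hzero]]]. exists M. split; [exact HM|].
    intros x Hx. apply is_derive_unique. apply is_derive_ext_loc with (fun _ => 0).
    + apply filter_imp with (2 := Rabs_gt_open M x Hx). intros y Hy.
      rewrite (Hzero y Hy). symmetry. apply Rmult_0_r.
    + apply @is_derive_const.
Qed.

Lemma test_function_continuous (psi : R -> R) (x : R) :
  test_function psi -> continuous psi x.
Proof. intros [Hpsi _]. exact (Hpsi 0%nat x I). Qed.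

Lemma compact_support_bounded (f : R -> R) (M : R) :
  0 < M -> (forall x, continuous f x) -> (forall x, M < Rabs x -> f x = 0) ->
  exists B, 0 <= B /\ forall x, Rabs (f x) <= B.
Proof.
  intros HM Hf Hzero.
  destruct (continuity_ab_maj (fun x => Rabs (f x)) (- M) M) as [m [Hm _]].
  - lra.
  - intros c _. apply continuity_pt_filterlim.
    apply (continuous_comp f Rabs); [apply Hf | apply continuous_Rabs].
  - exists (Rabs (f m)). split; [apply Rabs_pos|]. intros x.
    destruct (Rle_lt_dec (Rabs x) M) as [Hx | Hx].
    + apply Hm. now apply Rabs_le_between.
    + rewrite (Hzero x Hx), Rabs_R0. apply Rabs_pos.
Qed.

(** The mean value theorem is used twice: p(y) - p(x) = p'(c) (y - x), then p'(c) - p'(x) = p''(d)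
    (c - x), with |c - x| <= |y - x| because c lies between x and y. *)
Lemma taylor_remainder (p p' p'' : R -> R) (K x y : R) :
  (forall z, is_derive p z (p' z)) -> (forall z, is_derive p' z (p'' z)) ->
  (forall z, Rabs (p'' z) <= K) ->
  Rabs (p y - p x - (y - x) * p' x) <= K * (y - x) ^ 2.
Proof.
  intros Hp Hp' HK.
  assert (MV : forall f f' : R -> R, (forall z, is_derive f z (f' z)) ->
    forall a b, exists c, Rmin a b <= c <= Rmax a b /\ f b - f a = f' c * (b - a)).
  { intros f f' Hf a b. apply MVT_gen.
    - intros z _. apply Hf.
    - intros z _. apply continuity_pt_filterlim.
      apply (@ex_derive_continuous R_AbsRing R_NormedModule). now exists (f' z). }
  destruct (MV p p' Hp x y) as [c [Hc Ec]].
  destruct (MV p' p'' Hp' x c) as [d [_ Ed]].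
  replace (p y - p x - (y - x) * p' x) with (p'' d * ((c - x) * (y - x)))
    by (rewrite Ec; nra).
  rewrite Rabs_mult. apply Rmult_le_compat; [apply Rabs_pos..|apply HK|].
  rewrite Rabs_mult, <- (pow2_abs (y - x)). simpl. rewrite Rmult_1_r.
  apply Rmult_le_compat_r; [apply Rabs_pos|].
  unfold Rmin, Rmax in Hc. destruct (Rle_dec x y).
  - rewrite !Rabs_pos_eq; lra.
  - rewrite !Rabs_left1; lra.
Qed.

(** * The kernel exp(i t / x^alpha) and its integrals against compactly supported amplitudes *)

Definition osc (alpha t x : R) : C :=
  (cos (t / Rpower x alpha), sin (t / Rpower x alpha)).

Definition osc_integrand (alpha t : R) (psi : R -> R) (x : R) : C_R_NormedModule :=
  scal (psi x) (osc alpha t x : C_R_NormedModule).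

Lemma osc_integrand_Cexp (alpha t : R) (psi : R -> R) (x : R) :
  Cmult (Cexp (Cmult (Cmult Ci t) (Cdiv 1 (Rpower x alpha)))) (psi x)
  = osc_integrand alpha t psi x.
Proof.
  assert (Hp : Rpower x alpha <> 0) by (apply Rgt_not_eq, exp_pos).
  unfold osc_integrand. rewrite scal_R_Cmult, Cmult_comm. f_equal.
  rewrite <- RtoC_div by exact Hp. unfold Cexp, Ci, Cmult, RtoC, osc; simpl.
  replace ((0 * t - 1 * 0) * (1 / Rpower x alpha) - (0 * 0 + 1 * t) * 0)
    with 0 by ring.
  replace ((0 * t - 1 * 0) * 0 + (0 * 0 + 1 * t) * (1 / Rpower x alpha))
    with (t / Rpower x alpha) by (unfold Rdiv; ring).
  now rewrite exp_0, !Rmult_1_l.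
Qed.

Lemma norm_osc (alpha t x : R) : norm (osc alpha t x : C_R_NormedModule) = 1.
Proof.
  rewrite <- Cmod_norm. unfold Cmod, osc. simpl fst; simpl snd.
  rewrite <- sqrt_1. f_equal. rewrite <- !Rsqr_pow2, Rplus_comm. apply sin2_cos2.
Qed.

Lemma is_derive_Rpower (c x : R) :
  0 < x -> is_derive (fun y => Rpower y c) x (c * Rpower x (c - 1)).
Proof. intros Hx. apply is_derive_Reals. now apply derivable_pt_lim_power. Qed.

Lemma continuous_osc (alpha t x : R) :
  0 < x -> continuous (fun y => osc alpha t y : C_R_NormedModule) x.
Proof.
  intros Hx.
  assert (Hq : continuous (fun y => t / Rpower y alpha) x).
  { apply (continuous_mult (fun _ => t) (fun y => / Rpower y alpha)).
    - apply continuous_const.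
    - apply continuous_Rinv_comp.
      + apply (@ex_derive_continuous R_AbsRing R_NormedModule).
        eexists. now apply is_derive_Rpower.
      + apply Rgt_not_eq, exp_pos. }
  (* The pair is split as cos times (1, 0) plus sin times (0, 1), reducing continuity to that of the
     real coefficients. *)
  apply continuous_ext with (fun y : R =>
    plus (scal (cos (t / Rpower y alpha)) ((1, 0) : C_R_NormedModule))
         (scal (sin (t / Rpower y alpha)) ((0, 1) : C_R_NormedModule))).
  - intros y. unfold osc.
    apply injective_projections; simpl; unfold plus, scal, mult; simpl;
      unfold mult; simpl; ring.
  - apply (continuous_plus (V := C_R_NormedModule)
      (fun y : R => scal (cos (t / Rpower y alpha)) ((1, 0) : C_R_NormedModule))
      (fun y : R => scal (sin (t / Rpower y alpha)) ((0, 1) : C_R_NormedModule)));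
    apply (continuous_scal (V := C_R_NormedModule)); try apply continuous_const.
    + now apply continuous_cos_comp.
    + now apply continuous_sin_comp.
Qed.

(** The kernel has modulus 1, so the integrand inherits the bound and the cutoff of the amplitude.
    The cutoff is taken at [M + 1] because [psi] is only assumed to vanish strictly beyond [M]. *)
Lemma is_RInt_gen_osc (alpha t : R) (psi : R -> R) (M B : R) :
  0 < M -> (forall x, continuous psi x) ->
  (forall x, M < x -> psi x = 0) -> (forall x, 0 < x -> Rabs (psi x) <= B) ->
  exists l : C_R_NormedModule,
    is_RInt_gen (osc_integrand alpha t psi) (at_right 0) (Rbar_locally p_infty) l
    /\ norm l <= (M + 1) * B.
Proof.
  intros HM Hpsi Hzero Hbound.
  apply (is_RInt_gen_cutoff (V := C_R_CompleteNormedModule)).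
  - lra.
  - intros x Hx. apply (continuous_scal (V := C_R_NormedModule)); [apply Hpsi|].
    now apply continuous_osc.
  - intros x Hx. eapply Rle_trans.
    + apply (@norm_scal R_AbsRing C_R_NormedModule).
    + rewrite norm_osc, Rmult_1_r. now apply Hbound.
  - intros x Hx. unfold osc_integrand. rewrite Hzero by lra.
    apply (@scal_zero_l R_Ring C_R_NormedModule).
Qed.

(** [RInt_gen] is a total operator; convergence makes [I_alpha] a genuine limit, to which linearity
    and substitution apply. *)
Lemma is_RInt_gen_I_alpha (alpha t : R) (psi : R -> R) :
  test_function psi ->
  is_RInt_gen (osc_integrand alpha t psi) (at_right 0) (Rbar_locally p_infty)
    (I_alpha alpha psi t).
Proof.
  intros Hpsi. pose proof Hpsi as [_ [M [HM Hzero]]].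
  destruct (compact_support_bounded psi M HM) as [B [_ HB]].
  - intros x. now apply test_function_continuous.
  - exact Hzero.
  - destruct (is_RInt_gen_osc alpha t psi M B HM) as [l [Hl _]].
    + intros x. now apply test_function_continuous.
    + intros x Hx. apply Hzero. rewrite Rabs_pos_eq; lra.
    + intros x _. apply HB.
    + assert (E : I_alpha alpha psi t = l).
      { apply (is_RInt_gen_unique (V := C_R_CompleteNormedModule)).
        apply (is_RInt_gen_ext (osc_integrand alpha t psi)); [|exact Hl].
        apply filter_forall. intros ab x _. symmetry. apply osc_integrand_Cexp. }
      now rewrite E.
Qed.

(** * Dilation invariance and the second order expansion at s = 1 *)

Lemma osc_dilate (alpha t s x : R) :
  0 < s -> 0 < x -> osc alpha (t * Rpower s alpha) (s * x) = osc alpha t x.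
Proof.
  intros Hs Hx. unfold osc. rewrite <- (Rpower_mult_distr s x) by assumption.
  replace (t * Rpower s alpha / (Rpower s alpha * Rpower x alpha))
    with (t / Rpower x alpha); [reflexivity|].
  field. split; apply Rgt_not_eq, exp_pos.
Qed.

Lemma is_RInt_gen_I_alpha_dilate (alpha t s : R) (psi : R -> R) :
  test_function psi -> 0 < s ->
  is_RInt_gen (osc_integrand alpha t (fun x => s * psi (s * x)))
    (at_right 0) (Rbar_locally p_infty)
    (I_alpha alpha psi (t * Rpower s alpha)).
Proof.
  intros Hpsi Hs.
  apply (is_RInt_gen_ext (fun x =>
    scal s (osc_integrand alpha (t * Rpower s alpha) psi (s * x)))).
  (* The kernel identity is available only for x > 0, so both endpoints are first made positive. *)
  - apply Filter_prod with (fun u => 0 < u) (fun v => 0 < v).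
    + apply filter_imp with (2 := at_right_0_lt 1 Rlt_0_1). tauto.
    + now exists 0.
    + intros u v Hu Hv x [Hx _]. simpl in Hx.
      apply Rlt_trans with (1 := Rmin_pos u v Hu Hv) in Hx.
      unfold osc_integrand. rewrite osc_dilate by assumption.
      apply (@scal_assoc R_Ring C_R_NormedModule).
  - apply is_RInt_gen_dilate; [exact Hs|]. now apply is_RInt_gen_I_alpha.
Qed.

(** This is Taylor's bound for p(y) = y psi(y) between x and s x: there the remainder is x times the
    expression at hand, bounded by K x^2 (s - 1)^2, and dividing by x leaves one factor x. *)
Lemma dilation_remainder (psi : R -> R) :
  test_function psi ->
  exists K, 0 <= K /\ forall s x, 0 < x ->
    Rabs (s * psi (s * x) - psi x - (s - 1) * dil psi x) <= K * x * (s - 1) ^ 2.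
Proof.
  intros Hpsi. pose proof (test_function_dil psi Hpsi) as Hdil.
  destruct (proj1 Hdil 1%nat) as [g [Hg Hgc]].
  pose proof Hdil as [_ [M [HM Hzero]]].
  destruct (compact_support_bounded g M HM) as [K [HK HgK]].
  - intros x. now apply Hgc.
  - intros x Hx. rewrite <- (is_derive_unique _ _ _ (Hg x I)).
    apply is_derive_unique. apply is_derive_ext_loc with (fun _ => 0).
    + apply filter_imp with (2 := Rabs_gt_open M x Hx). intros y Hy.
      symmetry. now apply Hzero.
    + apply @is_derive_const.
  - exists K. split; [exact HK|]. intros s x Hx.
    pose proof (taylor_remainder (fun y => y * psi y) (dil psi) g K x (s * x)
      (fun z => is_derive_dil psi z Hpsi) (fun z => Hg z I) HgK) as HT.
    apply Rmult_le_reg_l with x; [exact Hx|].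
    rewrite <- (Rabs_pos_eq x) at 1 by lra. rewrite <- Rabs_mult.
    eapply Rle_trans; [|eapply Rle_trans; [exact HT|]].
    + right. f_equal. ring.
    + right. ring.
Qed.

(** By linearity the left side is the integral of the kernel against the pointwise remainder [r],
    whose size and support are controlled uniformly for s >= 1/2. *)
Lemma I_alpha_dilation_remainder (alpha t : R) (psi : R -> R) :
  test_function psi ->
  exists K, 0 <= K /\ forall s, / 2 <= s ->
    norm (minus (minus (I_alpha alpha psi (t * Rpower s alpha)) (I_alpha alpha psi t))
            (scal (s - 1) (I_alpha alpha (dil psi) t)) : C_R_NormedModule)
    <= K * (s - 1) ^ 2.
Proof.
  intros Hpsi. pose proof (test_function_dil psi Hpsi) as Hdil.
  destruct (dilation_remainder psi Hpsi) as [K [HK Hrem]].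
  pose proof Hpsi as [_ [M [HM Hzero]]].
  pose proof Hdil as [_ [M' [HM' Hzero']]].
  (* For x > [N] and s >= 1/2 one has s x > [M], x > [M] and x > [M'], so all three terms of the
     remainder vanish. *)
  set (N := 2 * M + M'). assert (HN : 0 < N) by (unfold N; lra).
  exists ((N + 1) * (K * N)). split.
  { apply Rmult_le_pos; [lra|]. apply Rmult_le_pos; lra. }
  intros s Hs.
  set (r := fun x => s * psi (s * x) - psi x - (s - 1) * dil psi x).
  assert (Hr0 : forall x, N < x -> r x = 0).
  { intros x Hx. unfold r, N in *.
    rewrite (Hzero (s * x)), (Hzero x), (Hzero' x); [ring|..];
      rewrite Rabs_pos_eq; nra. }
  destruct (is_RInt_gen_osc alpha t r N (K * N * (s - 1) ^ 2)) as [l [Hl Hln]].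
  - exact HN.
  - intros x.
    assert (Hc : continuous (fun y => s * psi (s * y)) x).
    { apply (continuous_scal_r (V := R_NormedModule) s (fun y => psi (s * y))).
      apply (continuous_comp (fun y => s * y) psi).
      - apply (continuous_scal_r (V := R_NormedModule) s (fun y => y)).
        apply continuous_id.
      - now apply test_function_continuous. }
    apply (continuous_minus (V := R_NormedModule)
      (fun y => s * psi (s * y) - psi y) (fun y => (s - 1) * dil psi y)).
    + apply (continuous_minus (V := R_NormedModule) _ psi); [exact Hc|].
      now apply test_function_continuous.
    + apply (continuous_scal_r (V := R_NormedModule) (s - 1) (dil psi)).
      now apply test_function_continuous.
  - exact Hr0.
  - intros x Hx. destruct (Rle_lt_dec x N) as [HxN | HxN].
    + apply Rle_trans with (1 := Hrem s x Hx).
      apply Rmult_le_compat_r; [apply pow2_ge_0|]. now apply Rmult_le_compat_l.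
    + rewrite Hr0, Rabs_R0 by exact HxN.
      apply Rmult_le_pos; [|apply pow2_ge_0]. apply Rmult_le_pos; lra.
  - assert (Hl' : is_RInt_gen (osc_integrand alpha t r)
      (at_right 0) (Rbar_locally p_infty)
      (minus (minus (I_alpha alpha psi (t * Rpower s alpha)) (I_alpha alpha psi t))
            (scal (s - 1) (I_alpha alpha (dil psi) t)) : C_R_NormedModule)).
    { apply (is_RInt_gen_ext (V := C_R_NormedModule) (fun x =>
        minus (minus (osc_integrand alpha t (fun x => s * psi (s * x)) x)
                     (osc_integrand alpha t psi x))
              (scal (s - 1) (osc_integrand alpha t (dil psi) x)))).
      - apply filter_forall. intros ab x _. unfold osc_integrand, r.
        apply injective_projections; simpl; unfold minus, plus, opp, scal, mult;
          simpl; unfold mult; simpl; ring.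
      - apply (is_RInt_gen_minus (V := C_R_NormedModule)).
        + apply (is_RInt_gen_minus (V := C_R_NormedModule)).
          * apply is_RInt_gen_I_alpha_dilate; [exact Hpsi | lra].
          * now apply is_RInt_gen_I_alpha.
        + apply (is_RInt_gen_scal (V := C_R_NormedModule)).
          now apply is_RInt_gen_I_alpha. }
    apply (is_RInt_gen_unique (V := C_R_CompleteNormedModule)) in Hl, Hl'.
    rewrite <- Hl', Hl. eapply Rle_trans; [exact Hln|]. right. ring.
Qed.

(** * The derivative of [I_alpha] and smoothness away from 0 *)

Lemma is_derive_quadratic_remainder {V : NormedModule R_AbsRing}
    (F : R -> V) (x0 : R) (l : V) (d K : R) :
  0 < d -> 0 <= K ->
  (forall x, Rabs (x - x0) < d ->
    norm (minus (minus (F x) (F x0)) (scal (x - x0) l)) <= K * (x - x0) ^ 2) ->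
  is_derive F x0 l.
Proof.
  intros Hd HK HF. split; [apply is_linear_scal_l|].
  intros y Hy eps.
  (* The differential is tested at every limit y of the neighbourhood filter of [x0]; uniqueness of
     limits leaves only [x0]. *)
  apply (@is_filter_lim_locally_unique R_AbsRing (AbsRing_NormedModule R_AbsRing)) in Hy.
  subst y.
  (* K h^2 <= eps |h| as soon as |h| <= eps / (K + 1); the added 1 covers K = 0. *)
  assert (He : 0 < Rmin d (eps / (K + 1))).
  { apply Rmin_pos; [exact Hd|]. apply Rdiv_lt_0_compat; [apply cond_pos | lra]. }
  exists (mkposreal _ He). intros x Hx.
  change (Rabs (x - x0) < Rmin d (eps / (K + 1))) in Hx.
  eapply Rle_trans; [apply HF; eapply Rlt_le_trans; [exact Hx | apply Rmin_l]|].
  change (K * (x - x0) ^ 2 <= eps * Rabs (x - x0)).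
  rewrite <- pow2_abs. simpl. rewrite Rmult_1_r, <- Rmult_assoc.
  apply Rmult_le_compat_r; [apply Rabs_pos|].
  assert (Hx' : Rabs (x - x0) <= eps / (K + 1)).
  { left. eapply Rlt_le_trans; [exact Hx | apply Rmin_r]. }
  apply Rle_trans with ((K + 1) * (eps / (K + 1))).
  - apply Rmult_le_compat; [exact HK | apply Rabs_pos | lra | exact Hx'].
  - right. field. lra.
Qed.

Lemma is_derive_I_alpha (alpha t : R) (psi : R -> R) :
  0 < alpha -> test_function psi -> t <> 0 ->
  is_derive (V := C_R_NormedModule) (I_alpha alpha psi) t
    (scal (/ (alpha * t)) (I_alpha alpha (dil psi) t : C_R_NormedModule)).
Proof.
  intros Ha Hpsi Ht.
  set (F := fun s => I_alpha alpha psi (t * Rpower s alpha) : C_R_NormedModule).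
  (* [sigma y] solves t s^alpha = y for s; near t the ratio y / t is positive whatever the sign of
     t, so negative t needs no separate case. *)
  set (sigma := fun y => Rpower (y / t) (/ alpha)).
  assert (Hsigma : sigma t = 1).
  { unfold sigma. replace (t / t) with 1 by (now field).
    unfold Rpower. now rewrite ln_1, Rmult_0_r, exp_0. }
  assert (HF1 : F 1 = I_alpha alpha psi t).
  { unfold F, Rpower. now rewrite ln_1, Rmult_0_r, exp_0, Rmult_1_r. }
  assert (HF : is_derive F 1 (I_alpha alpha (dil psi) t : C_R_NormedModule)).
  { destruct (I_alpha_dilation_remainder alpha t psi Hpsi) as [K [HK Hrem]].
    (* Radius 1/2 around s = 1 keeps s >= 1/2, the range of the remainder bound. *)
    apply is_derive_quadratic_remainder with (/ 2) K; [lra | exact HK |].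
    intros s Hs. rewrite HF1. apply Hrem.
    apply Rabs_lt_between in Hs. lra. }
  assert (Hds : is_derive sigma t (/ (alpha * t))).
  { unfold sigma.
    replace (/ (alpha * t)) with (/ t * (/ alpha * Rpower (t / t) (/ alpha - 1))).
    - apply (is_derive_comp (V := R_NormedModule)
               (fun z => Rpower z (/ alpha)) (fun y => y / t)).
      + apply is_derive_Rpower. replace (t / t) with 1 by (now field). lra.
      + auto_derive; [exact I|]. now field.
    - replace (t / t) with 1 by (now field).
      unfold Rpower. rewrite ln_1, Rmult_0_r, exp_0. field. lra. }
  apply is_derive_ext_loc with (fun y => F (sigma y)).
  - assert (Hpos : locally t (fun y => 0 < y / t)).
    { apply (open_comp (fun y => y / t) (fun z => 0 < z)).
      - intros z _. apply (continuous_scal_l (V := R_NormedModule) (fun y => y)).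
        apply continuous_id.
      - apply open_gt.
      - replace (t / t) with 1 by (now field). lra. }
    apply filter_imp with (2 := Hpos). intros y Hy. unfold F, sigma.
    rewrite Rpower_mult, Rinv_l, Rpower_1 by lra. f_equal. now field.
  - apply (is_derive_comp (V := C_R_NormedModule) F sigma); [|exact Hds].
    now rewrite Hsigma.
Qed.

(** The induction treats all test functions at once, since differentiating replaces [psi] by
    [dil psi]; the extra factor 1 / (alpha t) is smooth off 0. *)
Lemma Ck_on_I_alpha (k : nat) (alpha : R) (psi : R -> R) :
  0 < alpha -> test_function psi ->
  Ck_on (V := C_R_NormedModule) k (fun t => t <> 0) (I_alpha alpha psi).
Proof.
  intros Ha. revert psi. induction k as [|k IH]; intros psi Hpsi.
  - intros t Ht. apply (@ex_derive_continuous R_AbsRing C_R_NormedModule).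
    eexists. now apply is_derive_I_alpha.
  - exists (fun t => scal (/ (alpha * t)) (I_alpha alpha (dil psi) t : C_R_NormedModule)).
    split.
    + intros t Ht. now apply is_derive_I_alpha.
    + apply (Ck_on_scal (V := C_R_NormedModule) k _ (fun t => / (alpha * t))).
      * apply Ck_on_ext with (fun t => / alpha * / t).
        -- exact (open_neq 0).
        -- intros t Ht. symmetry. apply Rinv_mult.
        -- apply (Ck_on_scal (V := R_NormedModule) k _ (fun _ => / alpha) Rinv).
           ++ exact (Ck_on_const k _ (/ alpha : R_NormedModule)).
           ++ apply Ck_on_Rinv.
      * apply IH. now apply test_function_dil.
Qed.

(** * From compact support in an interval to test functions on the line *)

Lemma open_Rbar_ointerval (a b : Rbar) : open (Rbar_ointerval a b).
Proof. apply open_and; [apply open_Rbar_gt | apply open_Rbar_lt]. Qed.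

Lemma not_tsupport_locally_zero (f : R -> R) (x : R) :
  ~ tsupport f x -> locally x (fun y => f y = 0).
Proof.
  intros Hx. apply NNPP. intros Hn. apply Hx. intros W [d Hd].
  apply NNPP. intros Hempty. apply Hn. exists d. intros y Hy.
  apply NNPP. intros Hfy. apply Hempty. exists y. split; [|exact Hfy].
  now apply Hd.
Qed.

(** A point of the closed support lies in the interval, where [phi] is smooth; any other point has a
    neighbourhood where [phi] is 0. This is the dichotomy required for gluing. *)
Lemma test_function_of_compact_support (a b : Rbar) (phi : R -> R) :
  Cinfty_on (V := R_NormedModule) (Rbar_ointerval a b) phi ->
  compact (tsupport phi) -> included (tsupport phi) (Rbar_ointerval a b) ->
  test_function phi.
Proof.
  intros Hphi Hcomp Hincl. split.
  - intros k. apply Ck_on_extend_zero with (Rbar_ointerval a b).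
    + apply open_Rbar_ointerval.
    + intros x. destruct (classic (tsupport phi x)) as [Hx | Hx].
      * left. now apply Hincl.
      * right. now apply not_tsupport_locally_zero.
    + apply Hphi.
  - destruct (compact_P1 _ Hcomp) as [m [M HmM]].
    (* The support lies in [m, M], hence within |m| + |M| of 0; adding 1 makes the radius
       positive. *)
    exists (Rabs m + Rabs M + 1). split.
    + pose proof (Rabs_pos m). pose proof (Rabs_pos M). lra.
    + intros x Hx. destruct (classic (tsupport phi x)) as [Hs | Hs].
      * exfalso. specialize (HmM x Hs). revert Hx. unfold Rabs.
        destruct (Rcase_abs x), (Rcase_abs m), (Rcase_abs M); lra.
      * exact (locally_singleton _ _ (not_tsupport_locally_zero phi x Hs)).
Qed.

Theorem corollary1p3 (alpha : R) (halpha : 0 < alpha)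
    (a b : Rbar) (hab : Rbar_ointerval a b 0)
    (phi : R -> R)
    (hphi : Cinfty_on (V := R_NormedModule) (Rbar_ointerval a b) phi)
    (hcompact : compact (tsupport phi))
    (hsupp : included (tsupport phi) (Rbar_ointerval a b)) :
  Cinfty_on (V := C_R_NormedModule) (fun t : R => t <> 0) (I_alpha alpha phi).
Proof.
  intros k. apply Ck_on_I_alpha; [exact halpha|].
  now apply test_function_of_compact_support with a b.
Qed.
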